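(* Let $n\geq 1$ and let $\mathcal{A}$ be a (possibly infinite) commuting family of $n\times n$ complex matrices which is uniformly power bounded and has the uniform Jordan property. Then there exists an invertible $n\times n$ complex matrix $Y$ such that $YTY^{-1}$ is a contraction for every $T\in\mathcal{A}$.
   Context: The norm of an $n\times n$ complex matrix is its operator norm on the Hilbert space $\mathbb{C}^n$ (Euclidean norm); a contraction is a matrix of norm at most $1$. A family $\mathcal{A}$ is commuting if any two of its elements commute. It is uniformly power bounded if there is a constant $K>0$ such that $\|T^p\|\leq K$ for every $T\in\mathcal{A}$ and every positive integer $p$. For a matrix $T$, $\Delta(T)$ denotes the set of eigenvalues $\lambda$ of $T$ that appear in a Jordan block of size at least $2$ in the Jordan canonical form of $T$; equivalently, the $\lambda$ with $\ker(T-\lambda I)\neq\ker(T-\lambda I)^2$. The family $\mathcal{A}$ has the uniform Jordan property if $$\inf_{T\in\mathcal{A}}\ \min_{\lambda\in\Delta(T)}\left\|(T-\lambda I)|_{\ker(T-\lambda I)^2}\right\|>0,$$ where the minimum over an empty set is $+\infty$ (so matrices with $\Delta(T)=\varnothing$ impose no condition). *)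

(* Defs.v *)
From mathcomp Require Import all_boot all_order all_algebra.
From mathcomp Require Import all_classical all_reals ereal.
From mathcomp Require Import complex.

Set Implicit Arguments.
Unset Strict Implicit.
Unset Printing Implicit Defensive.

Import Order.TTheory GRing.Theory Num.Theory.

Local Open Scope classical_set_scope.
Local Open Scope ring_scope.

(* [normc] is the modulus with values in [R]; the norm [`|z|] of [R[i]] takes
   values in [R[i]]. *)
Definition l2norm (R : realType) (n : nat) (v : 'cV[R[i]]_n) : R :=
  Num.sqrt (\sum_(i < n) ComplexField.Normc.normc (v i 0) ^+ 2).

(* Matrices act on column vectors. The set of norms below is bounded, and
   nonempty as soon as 0 is in V, so that [sup] is a genuine supremum. *)
Definition opnorm_on (R : realType) (n : nat) (V : set 'cV[R[i]]_n)
    (T : 'M[R[i]]_n) : R :=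
  sup [set l2norm (T *m v) | v in V `&` [set v | l2norm v <= 1]].

Definition opnorm (R : realType) (n : nat) (T : 'M[R[i]]_n) : R :=
  opnorm_on setT T.

Definition contraction (R : realType) (n : nat) (T : 'M[R[i]]_n) : Prop :=
  opnorm T <= 1.

Definition commuting_family (R : realType) (n : nat)
    (A : set 'M[R[i]]_n) : Prop :=
  forall S T, A S -> A T -> comm_mx S T.

Definition uniformly_power_bounded (R : realType) (n : nat)
    (A : set 'M[R[i]]_n) : Prop :=
  exists2 K : R, 0 < K &
    forall T, A T -> forall p : nat, (0 < p)%N -> opnorm (T ^+ p) <= K.

(* The kernel of the action on column vectors; MathComp's [kermx] is the
   kernel of the action on row vectors. *)
Definition colker (R : realType) (n : nat) (T : 'M[R[i]]_n) :
  set 'cV[R[i]]_n := [set v | T *m v = 0].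

(* The eigenvalues with a Jordan block of size at least 2: those for which
   ker (T - a I) and ker (T - a I)^2 differ. *)
Definition Delta (R : realType) (n : nat) (T : 'M[R[i]]_n) : set R[i] :=
  [set a | colker (T - a%:M) <> colker ((T - a%:M) ^+ 2)].

(* [Delta T] is finite, so the inner infimum is a minimum, equal to [+oo] when
   [Delta T] is empty. *)
Definition uniform_jordan (R : realType) (n : nat)
    (A : set 'M[R[i]]_n) : Prop :=
  (0 < ereal_inf
         [set ereal_inf
                [set (opnorm_on (colker ((T - a%:M) ^+ 2)) (T - a%:M))%:E
                | a in Delta T]
         | T in A])%E.

(* Main.v *)
Require Import Defs.
From mathcomp Require Import all_boot all_order all_algebra.
From mathcomp Require Import all_classical all_reals ereal.
From mathcomp Require Import complex ring lra.

(* The space splits into the joint generalized eigenspaces of the family, on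
   each of which the family is simultaneously triangular with constant
   diagonal: after one change of basis, an off-diagonal entry of T can be
   nonzero only when the two corresponding diagonal entries equal the same
   element of [Delta T]. For a in [Delta T] and v in ker (T - a)^2,
     T^p v = a^p v + p a^(p-1) (T - a) v,
   so power boundedness and the uniform Jordan property bound p |a|^(p-1)
   uniformly, which keeps |a| below 1 - c for some c > 0 independent of T.
   Conjugating by diag(e^i) with e small makes the off-diagonal entries at most
   c / n, and then all absolute row and column sums are at most 1. *)

Set Implicit Arguments.
Unset Strict Implicit.
Unset Printing Implicit Defensive.

Import Order.TTheory GRing.Theory Num.Theory.

Local Open Scope classical_set_scope.
Local Open Scope ring_scope.

Local Notation normc := ComplexField.Normc.normc.

(** Reduces a possibly infinite family to a finite one: a list from [A] whose span has maximal
    dimension spans all of [A], since adjoining a further element cannot enlarge the span. *)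
Lemma set_span_seq (K : fieldType) (V : vectType K) (A : set V) :
  exists2 s : seq V, (forall v, v \in s -> A v) &
    forall v, A v -> (v \in <<s>>)%VS.
Proof.
pose dimA d :=
  `[< exists2 s : seq V, (forall v, v \in s -> A v) & \dim <<s>> = d >].
have dimA0 : exists d, dimA d.
  by exists 0%N; apply/asboolP; exists [::]; rewrite ?span_nil ?dimv0.
have dimA_max d : dimA d -> (d <= \dim (fullv : {vspace V}))%N.
  by move=> /asboolP[s _ <-]; rewrite dimvS ?subvf.
case: (ex_maxnP dimA0 dimA_max) => d /asboolP[s sA <-] maxd.
exists s => // v Av.
have /maxd le_sv : dimA (\dim <<v :: s>>).
  apply/asboolP; exists (v :: s) => // w.
  by rewrite inE => /predU1P[->|/sA].
have /eqP -> : <<s>>%VS == <<v :: s>>%VS.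
  by rewrite eqEdim le_sv span_cons addvSr.
by rewrite memv_span ?mem_head.
Qed.

(** * Joint generalized eigenspaces and simultaneous triangular form *)

Section Structure.
Variable C : numClosedFieldType.

(** Triangularizing a finite spanning list suffices, because lower triangularity passes to linear
    combinations. *)
Lemma cotrigonalization_set n (A : set 'M[C]_n) :
  (forall S T, A S -> A T -> comm_mx S T) ->
  exists2 P, P \in unitmx & forall T, A T -> is_trig_mx (P *m T *m invmx P).
Proof.
move=> Acomm; have [s sA Aspan] := set_span_seq A.
have [S T Ss Ts|P /unitarymx_unit uP /allP trigP] := @cotrigonalization C n s.
  by apply: Acomm; apply: sA.
exists P => // T /Aspan Ts; rewrite (coord_span (X := in_tuple s) Ts).
apply/is_trig_mxP => i j ltij.
rewrite mulmx_sumr mulmx_suml summxE big1 // => k _.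
have := trigP _ (mem_nth 0 (ltn_ord k)); rewrite inE /similar_to conjumx//.
move=> /is_trig_mxP/(_ _ _ ltij) sk0.
by rewrite -scalemxAr -scalemxAl mxE sk0 mulr0.
Qed.

(* Joint eigenblocks need not be contiguous, so the block structure is recorded
   by the vanishing of entries linking distinct diagonal values; [is_trig_mx]
   means lower triangular. *)
Definition eigenblock_trig m (B : 'M[C]_m) : Prop :=
  is_trig_mx B /\ forall i j, B i j != 0 -> B i i = B j j.

Lemma eigenblock_trig_block m1 m2 (B1 : 'M[C]_m1) (B2 : 'M[C]_m2) :
  eigenblock_trig B1 -> eigenblock_trig B2 ->
  eigenblock_trig (block_mx B1 0 0 B2).
Proof.
move=> [trig1 diag1] [trig2 diag2]; split.
  by rewrite is_trig_block_mx // eqxx trig1 trig2.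
move=> i j; case: (splitP i) => i' ei; case: (splitP j) => j' ej.
- have -> : i = lshift m2 i' by apply: val_inj.
  have -> : j = lshift m2 j' by apply: val_inj.
  by rewrite !block_mxEul; apply: diag1.
- have -> : i = lshift m2 i' by apply: val_inj.
  have -> : j = rshift m1 j' by apply: val_inj.
  by rewrite block_mxEur mxE eqxx.
- have -> : i = rshift m1 i' by apply: val_inj.
  have -> : j = lshift m2 j' by apply: val_inj.
  by rewrite block_mxEdl mxE eqxx.
- have -> : i = rshift m1 i' by apply: val_inj.
  have -> : j = rshift m1 j' by apply: val_inj.
  by rewrite !block_mxEdr; apply: diag2.
Qed.

(** Since ['X - a] and [q] are coprime, the eigenspace of [a] meets the kernel of [q] at [T]
    trivially; were that kernel everything, [a] would have no eigenvector. *)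
Lemma kermxpoly_not_full n (T : 'M[C]_n) (a : C) (q : {poly C}) :
  eigenvalue T a -> ~~ root q a -> (\rank (kermxpoly T q) < n)%N.
Proof.
move=> Ta qa; rewrite ltn_neqAle rank_leq_row andbT.
apply: contra Ta => rkq; have full_q : row_full (kermxpoly T q) by [].
have coprime_q : coprimep ('X - a%:P) q by rewrite coprimep_sym coprimep_XsubC.
rewrite eigenspace_poly -submx0 -(mxdirect_kermxpoly T coprime_q).
by rewrite sub_capmx submx_refl submx_full.
Qed.

(** Write the characteristic polynomial as [q * p] with [p] a power of ['X - a] and [q] nonzero at
    [a]. The kernels of [p] and [q] at [T] are complementary and stable under every matrix commuting
    with [T]; the eigenvalues [b] and [a] show that each is proper. [P1], [P2] are row bases of the
    two kernels, and [Q1], [Q2] the column blocks of the inverse of the stacked basis. *)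
Lemma eigenvalue_split n (T : 'M[C]_n) (a b : C) :
  a != b -> eigenvalue T a -> eigenvalue T b ->
  exists n1 n2 (P1 : 'M[C]_(n1, n)) (P2 : 'M[C]_(n2, n))
    (Q1 : 'M[C]_(n, n1)) (Q2 : 'M[C]_(n, n2)),
  [/\ (n1 < n)%N /\ (n2 < n)%N, P1 *m Q1 = 1%:M /\ P2 *m Q2 = 1%:M,
      P1 *m Q2 = 0 /\ P2 *m Q1 = 0, Q1 *m P1 + Q2 *m P2 = 1%:M &
      forall S, comm_mx T S -> P1 *m S *m Q2 = 0 /\ P2 *m S *m Q1 = 0].
Proof.
move=> neq_ab Ta Tb.
have [k [q /=]] := multiplicity_XsubC (char_poly T) a.
have pT0 : char_poly T != 0 by rewrite monic_neq0 ?char_poly_monic.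
rewrite pT0 /= => qa0 defT.
pose p := ('X - a%:P) ^+ k : {poly C}.
have pb0 : ~~ root p b.
  by rewrite /root horner_exp hornerXsubC expf_neq0 // subr_eq0 eq_sym.
pose U := kermxpoly T p; pose W := kermxpoly T q.
have ltU : (\rank U < n)%N by apply: kermxpoly_not_full Tb pb0.
have ltW : (\rank W < n)%N by apply: kermxpoly_not_full Ta qa0.
have pq : coprimep p q by rewrite coprimep_expl // coprimep_sym coprimep_XsubC.
have capUW : (U :&: W = 0)%MS by apply: mxdirect_kermxpoly.
have sumUW : (U + W :=: 1%:M)%MS.
  apply: eqmx_trans (eqmx_sym (kermxpolyM _ pq)) _.
  (* Size 0 is trivial; in positive size Cayley-Hamilton makes the kernel of [q * p] the whole
     space. *)
  case: n T {Ta Tb} @U @W {capUW ltU ltW} pT0 defT => [|n] T U W pT0 defT.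
    by rewrite !thinmx0.
  by apply: kermxpoly_min; rewrite /p mulrC -defT mxminpoly_dvd_char.
pose M := col_mx (row_base U) (row_base W).
have freeM : row_free M.
  rewrite /row_free -addsmxE mxrank_disjoint_sum ?eq_row_base //.
  apply/eqP; rewrite -submx0 -capUW.
  by rewrite (cap_eqmx (eq_row_base _) (eq_row_base _)).
have fullM : row_full M.
  by rewrite -sub1mx -addsmxE (adds_eqmx (eq_row_base _) (eq_row_base _)) sumUW.
(* [M] is square only up to an equality of ranks, so its two-sided inverse comes from being both row
   free and row full. *)
pose Q := pinvmx M.
have MQ : M *m Q = 1%:M by apply: mulmxVp.
have QM : Q *m M = 1%:M by apply: mulVpmx.
move: MQ QM; rewrite -[Q]hsubmxK mul_col_row mul_row_col scalar_mx_block.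
move=> /eq_block_mx[P1Q1 P1Q2 P2Q1 P2Q2] QP.
exists (\rank U), (\rank W), (row_base U), (row_base W), (lsubmx Q), (rsubmx Q).
split=> // S TS; split.
  have : stablemx (row_base U) S.
    by rewrite stablemx_row_base comm_mx_stable_kermxpoly.
  by move=> /submxP[X ->]; rewrite -mulmxA P1Q2 mulmx0.
have : stablemx (row_base W) S.
  by rewrite stablemx_row_base comm_mx_stable_kermxpoly.
by move=> /submxP[X ->]; rewrite -mulmxA P2Q1 mulmx0.
Qed.

(** Inserting [Q1 *m P1 + Q2 *m P2] between [S] and [T] leaves only the first term, as
    [P1 *m S *m Q2 = 0]; compression is therefore multiplicative on [A]. *)
Lemma compress_commuting n n1 n2 (P1 : 'M[C]_(n1, n)) (P2 : 'M[C]_(n2, n))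
    (Q1 : 'M[C]_(n, n1)) (Q2 : 'M[C]_(n, n2)) (A : set 'M[C]_n) :
  Q1 *m P1 + Q2 *m P2 = 1%:M -> (forall S, A S -> P1 *m S *m Q2 = 0) ->
  (forall S T, A S -> A T -> comm_mx S T) ->
  forall S T, [set P1 *m S *m Q1 | S in A] S ->
    [set P1 *m S *m Q1 | S in A] T -> comm_mx S T.
Proof.
move=> QP PSQ Acomm.
have compressM S T : A S ->
    P1 *m S *m Q1 *m (P1 *m T *m Q1) = P1 *m (S *m T) *m Q1.
  move=> AS; rewrite -[S in RHS]mulmx1 -QP mulmxDr mulmxDl mulmxDr mulmxDl.
  by rewrite !mulmxA (PSQ _ AS) !mul0mx addr0.
move=> _ _ [S AS <-] [T AT <-].
by rewrite /comm_mx !compressM // (Acomm _ _ AS AT).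
Qed.

(** Strong induction on the size. If some member has two distinct eigenvalues, split the space and
    recurse on both compressions; otherwise any common triangularization has constant diagonals. The
    size [m] is left free so that the glued size [m1 + m2] needs no cast. *)
Lemma commuting_eigenblock_trig n (A : set 'M[C]_n) :
  (forall S T, A S -> A T -> comm_mx S T) ->
  exists m (P : 'M[C]_(m, n)) (Q : 'M[C]_(n, m)),
    [/\ P *m Q = 1%:M, Q *m P = 1%:M &
        forall T, A T -> eigenblock_trig (P *m T *m Q)].
Proof.
have [N] := ubnP n; elim: N n A => // N IH n A /ltnSE le_nN Acomm.
have [[T [a [b [AT neq_ab Ta Tb]]]]|one_eig] :=
  pselect (exists T a b, [/\ A T, a != b, eigenvalue T a & eigenvalue T b]).
  have [n1 [n2 [P1 [P2 [Q1 [Q2]]]]]] := eigenvalue_split neq_ab Ta Tb.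
  case=> -[lt1 lt2] [P1Q1 P2Q2] [P1Q2 P2Q1] QP PSQ.
  have {PSQ} PSQ S : A S -> P1 *m S *m Q2 = 0 /\ P2 *m S *m Q1 = 0.
    by move=> AS; apply: PSQ; apply: Acomm.
  have comm1 := compress_commuting QP (fun S AS => (PSQ S AS).1) Acomm.
  rewrite addrC in QP.
  have comm2 := compress_commuting QP (fun S AS => (PSQ S AS).2) Acomm.
  rewrite addrC in QP.
  have [m1 [R1 [S1 [RS1 SR1 trig1]]]] := IH _ _ (leq_trans lt1 le_nN) comm1.
  have [m2 [R2 [S2 [RS2 SR2 trig2]]]] := IH _ _ (leq_trans lt2 le_nN) comm2.
  exists (m1 + m2)%N, (col_mx (R1 *m P1) (R2 *m P2)),
    (row_mx (Q1 *m S1) (Q2 *m S2)); split.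
  - rewrite mul_col_row scalar_mx_block !mulmxA -!(mulmxA _ P1) -!(mulmxA _ P2).
    by rewrite P1Q1 P1Q2 P2Q1 P2Q2 !mulmx0 !mulmx1 !mul0mx RS1 RS2.
  - rewrite mul_row_col !mulmxA -(mulmxA Q1) -(mulmxA Q2).
    by rewrite SR1 SR2 !mulmx1.
  - move=> S AS; rewrite mul_col_mx mul_col_row !mulmxA.
    have [z12 z21] := PSQ _ AS.
    rewrite -!(mulmxA R1) -!(mulmxA R2) z12 z21 !mul0mx !mulmx0.
    by apply: eigenblock_trig_block; rewrite mulmxA;
      [apply: trig1|apply: trig2]; exists S.
have [P uP trigP] := cotrigonalization_set Acomm.
exists n, P, (invmx P); split; rewrite ?mulmxV ?mulVmx // => T AT.
split; first exact: trigP.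
move=> i j _; apply: contrapT => /eqP neq_ij; apply: one_eig.
have eigB l : eigenvalue T ((P *m T *m invmx P) l l).
  rewrite -conjumx //; apply: (eigenvalue_conjmx (V := P)).
  - exact: stablemx_unit.
  - by rewrite row_free_unit.
  rewrite -[_ \in _]/(eigenvalue _ _) eigenvalue_root_char conjumx //.
  rewrite char_poly_trig ?trigP //.
  rewrite -(big_map (fun i => (P *m T *m invmx P) i i) predT
    (fun x => 'X - x%:P)).
  by rewrite root_prod_XsubC; apply/mapP; exists l; rewrite ?mem_index_enum.
by exists T, ((P *m T *m invmx P) i i), ((P *m T *m invmx P) j j).
Qed.
End Structure.

(** * Nilpotency and semisimplicity read off the triangular form *)

Section JordanBlocks.
Variable C : numClosedFieldType.

(** A nonzero entry of [B - a] in a column with diagonal value [a] lies in a strictly lower row,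
    again with diagonal value [a]. Each factor thus raises the index, and [m - j] factors exhaust
    it. *)
Lemma expr_eigenblock_trig_sub m (B : 'M[C]_m) (a : C) :
  eigenblock_trig B ->
  forall k i j, B j j = a -> (m <= j + k)%N -> ((B - a%:M) ^+ k) i j = 0.
Proof.
move=> [/is_trig_mxP trigB diagB]; elim=> [|k IH] i j Bjj.
  by rewrite addn0 leqNgt ltn_ord.
move=> le_mjk; rewrite exprSr mxE big1 // => l _.
have [Blj|Blj] := eqVneq (B l j) 0.
  (* Subtracting [a] could matter only for [l = j], but then [a = B j j = 0]. *)
  rewrite [X in _ * X]mxE Blj add0r 2!mxE.
  have [elj|_] := eqVneq l j; last by rewrite mulr0n oppr0 mulr0.
  have a0 : a = 0 by rewrite -Bjj -Blj elj.
  by rewrite a0 mul0rn oppr0 mulr0.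
have [lt_lj|lt_jl|elj] := ltngtP l j.
- by rewrite trigB ?eqxx in Blj.
- by rewrite IH ?mul0r ?(diagB _ _ Blj) // (leq_trans le_mjk) //
    addnS -addSn leq_add2r.
- by rewrite (val_inj elj) !mxE Bjj eqxx mulr1n subrr mulr0.
Qed.

(** The basis vector of index [j] is killed by a power of [N]. The hypothesis collapses the kernels
    of all powers to that of [N], so column [j] of [N] vanishes. *)
Lemma eigenblock_trig_semisimple m (B : 'M[C]_m) (i j : 'I_m) :
  eigenblock_trig B ->
  (forall v : 'cV_m, (B - (B j j)%:M) ^+ 2 *m v = 0 ->
    (B - (B j j)%:M) *m v = 0) ->
  i != j -> B i j = 0.
Proof.
move=> trigB kerB neq_ij; set N := B - _ in kerB.
have kerN k : N ^+ k.+1 *m delta_mx j (0 : 'I_1) = 0 ->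
    N *m delta_mx j (0 : 'I_1) = 0.
  elim: k => [|k IH]; first by rewrite expr1.
  rewrite -[k.+2]add2n exprD -mulmxE -mulmxA => /kerB.
  by rewrite mulmxA mulmxE -exprS.
have Nm : N ^+ m.+1 *m delta_mx j (0 : 'I_1) = 0.
  rewrite -colE; apply/colP => l; rewrite !mxE.
  apply: expr_eigenblock_trig_sub trigB _ _ _ erefl _.
  by rewrite -addSnnS leq_addl.
have /colP/(_ i) := kerN _ Nm.
by rewrite -colE !mxE (negbTE neq_ij) mulr0n subr0.
Qed.

Lemma expr_trig_mx m (B : 'M[C]_m) p : is_trig_mx B ->
  is_trig_mx (B ^+ p) /\ forall i, (B ^+ p) i i = B i i ^+ p.
Proof.
move=> /is_trig_mxP trigB; elim: p => [|p [/is_trig_mxP trigp diagp]].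
  by split=> [|i]; rewrite ?scalar_mx_is_trig // mxE eqxx.
split=> [|i].
  apply/is_trig_mxP => i j lt_ij; rewrite exprSr mxE big1 // => l _.
  have [le_li|lt_il] := leqP l i.
    by rewrite trigB ?mulr0 // (leq_ltn_trans le_li).
  by rewrite trigp ?mul0r.
rewrite exprSr mxE (bigD1 i) //= big1 ?addr0 => [|l neq_li].
  by rewrite diagp exprSr.
have [lt_li|lt_il|/val_inj eli] := ltngtP l i.
- by rewrite trigB ?mulr0.
- by rewrite trigp ?mul0r.
- by rewrite eli eqxx in neq_li.
Qed.

End JordanBlocks.

(** * Elementary real inequalities *)

Section RealBounds.
Variable R : realType.

Lemma bernoulli_ge (y : R) p : 0 <= y <= 1 -> 1 - p%:R * y <= (1 - y) ^+ p.
Proof.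
move=> /andP[y0 y1]; elim: p => [|p IH]; first by rewrite mul0r subr0 expr0.
rewrite exprSr; apply: le_trans (ler_wpM2r _ IH); last by rewrite subr_ge0.
have : 0 <= p%:R * y * y by rewrite !mulr_ge0.
rewrite -natr1; nra.
Qed.

Lemma exp_bounded_le1 (x M : R) : 0 <= x ->
  (forall p, x ^+ p.+1 <= M) -> x <= 1.
Proof.
move=> x0 xM; rewrite leNgt; apply/negP => x1.
have ge_p p : 1 + p%:R * (x - 1) <= x ^+ p.
  elim: p => [|p IH]; first by rewrite mul0r addr0 expr0.
  rewrite exprSr; apply: le_trans (ler_wpM2r x0 IH).
  have : 0 <= p%:R * (x - 1) * (x - 1) by rewrite !mulr_ge0 // subr_ge0 ltW.
  rewrite -natr1; nra.
have y0 : 0 < x - 1 by rewrite subr_gt0.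
have := archi_boundP (normr_ge0 (M / (x - 1))); set p := Num.bound _ => ltp.
have {ltp} : M / (x - 1) < p%:R by apply: le_lt_trans ltp; apply: ler_norm.
rewrite ltr_pdivrMr // => ltM.
have := le_trans (ge_p p.+1) (xM p); rewrite -natr1; nra.
Qed.

(** Fix [p > 2 * M]. Bernoulli gives [(p + 1) * (1 - p * (1 - x)) <= M], hence [p * (1 - x) > 1/2],
    and [c = 1 / (2 * (p + 1))] depends on [M] alone. *)
Lemma uniform_gap (M : R) : exists2 c : R, 0 < c <= 1 &
  forall x, 0 <= x <= 1 -> (forall p, p.+1%:R * x ^+ p <= M) -> x <= 1 - c.
Proof.
have := archi_boundP (normr_ge0 (2 * M)); set p := Num.bound _ => ltp.
have {ltp} ltp : 2 * M < p%:R by apply: le_lt_trans ltp; apply: ler_norm.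
have p1 : 1 <= p.+1%:R :> R by rewrite ler1n.
exists (2 * p.+1%:R)^-1.
  rewrite invr_gt0 invf_le1; lra.
move=> x /andP[x0 x1] xM.
have /(bernoulli_ge p) : 0 <= 1 - x <= 1 by lra.
rewrite subKr => le_p.
have {le_p}le_p : p.+1%:R * (1 - p%:R * (1 - x)) <= M.
  by apply: le_trans (xM p); rewrite ler_wpM2l.
rewrite lerBrDr addrC -lerBrDr -div1r ler_pdivrMr; last by lra.
move: le_p ltp p1; rewrite -natr1; set q : R := p%:R => le_p ltp p1.
nra.
Qed.

(** Expand the weighted sum of squared deviations from [s]; total weight at most 1 suffices because
    it only multiplies [s ^+ 2]. *)
Lemma jensen_sqr n (b y : 'I_n -> R) :
  (forall j, 0 <= b j) -> \sum_j b j <= 1 ->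
  (\sum_j b j * y j) ^+ 2 <= \sum_j b j * y j ^+ 2.
Proof.
move=> b0 b1; set s := \sum_j b j * y j.
have : 0 <= \sum_j b j * (y j - s) ^+ 2.
  by apply: sumr_ge0 => j _; rewrite mulr_ge0 ?sqr_ge0.
have -> : \sum_j b j * (y j - s) ^+ 2 =
    \sum_j b j * y j ^+ 2 - 2 * s * s + (\sum_j b j) * s ^+ 2.
  have -> : 2 * s * s = \sum_j 2 * s * (b j * y j) by rewrite -mulr_sumr.
  rewrite mulr_suml -sumrB -big_split /=.
  by apply: eq_bigr => j _; ring.
have := sqr_ge0 s; nra.
Qed.

(** Either all terms other than [b i] vanish, or [b i] leaves room [c] for fewer than [n] terms of
    size at most [c / n]. *)
Lemma sum_dominated_le1 n (b : 'I_n -> R) (i : 'I_n) (c : R) :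
  0 <= c -> b i <= 1 -> (forall j, j != i -> b j <= c / n%:R) ->
  (forall j, j != i -> b j != 0 -> b i <= 1 - c) -> \sum_j b j <= 1.
Proof.
move=> c0 bi1 bjc bj0; rewrite (bigD1 i) //=.
have [[j [neq_ji bjN0]]|noj] := pselect (exists j, j != i /\ b j != 0).
  have bic := bj0 _ neq_ji bjN0.
  have n0 : 0 < n%:R :> R by rewrite ltr0n (leq_ltn_trans _ (ltn_ord i)).
  have : \sum_(j < n | j != i) b j <= c.
    apply: (@le_trans _ _ (\sum_(j < n) c / n%:R)).
      rewrite [leRHS](bigD1 i) //= -[leLHS]add0r lerD ?ler_sum //.
      by rewrite divr_ge0 // ltW.
    by rewrite sumr_const card_ord -[_ *+ n]mulr_natr divfK ?lt0r_neq0.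
  lra.
rewrite big1 ?addr0 // => j neq_ji.
by apply: contrapT => /eqP bj; apply: noj; exists j.
Qed.

End RealBounds.

(** * Euclidean and operator norms; growth of powers at defective eigenvalues *)

Section Norms.
Variable R : realType.
Local Notation C := R[i].

Lemma normc_ge0 (z : C) : 0 <= normc z.
Proof. by case: z => a b; apply: sqrtr_ge0. Qed.

Lemma normcX (z : C) p : normc (z ^+ p) = normc z ^+ p.
Proof.
elim: p => [|p IH]; first exact: ComplexField.Normc.normc1.
by rewrite !exprS ComplexField.Normc.normcM IH.
Qed.

Lemma normc_natr p : normc (p%:R : C) = p%:R.
Proof. by rewrite -[p%:R]/(1 *+ p) normcMn ComplexField.Normc.normc1. Qed.

Lemma normc_real (x : R) : 0 <= x -> normc x%:C%C = x.
Proof. by move=> x0; rewrite /= expr0n addr0 sqrtr_sqr ger0_norm. Qed.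

Lemma normc_sum n (z : 'I_n -> C) : normc (\sum_i z i) <= \sum_i normc (z i).
Proof.
elim/big_ind2: _ => [|x1 x2 y1 y2 le1 le2|//].
  by rewrite ComplexField.Normc.normc0.
by apply: le_trans (le_normcD _ _) _; apply: lerD.
Qed.

Lemma l2norm_ge0 n (v : 'cV[C]_n) : 0 <= l2norm v.
Proof. exact: sqrtr_ge0. Qed.

Lemma sqr_l2norm n (v : 'cV[C]_n) :
  l2norm v ^+ 2 = \sum_i normc (v i 0) ^+ 2.
Proof. by rewrite sqr_sqrtr // sumr_ge0 // => i _; rewrite sqr_ge0. Qed.

Lemma normc_le_l2norm n (v : 'cV[C]_n) i : normc (v i 0) <= l2norm v.
Proof.
rewrite -ler_sqr ?nnegrE ?normc_ge0 ?l2norm_ge0 // sqr_l2norm (bigD1 i) //=.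
by rewrite lerDl sumr_ge0 // => j _; rewrite sqr_ge0.
Qed.

Lemma l2norm_le_sum n (v : 'cV[C]_n) : l2norm v <= \sum_i normc (v i 0).
Proof.
have sum0 (P : pred 'I_n) : 0 <= \sum_(i | P i) normc (v i 0).
  by rewrite sumr_ge0 // => i _; apply: normc_ge0.
rewrite -ler_sqr ?nnegrE ?l2norm_ge0 // sqr_l2norm expr2 mulr_suml.
apply: ler_sum => i _; rewrite expr2 ler_wpM2l ?normc_ge0 //.
by rewrite (bigD1 i) //= lerDl.
Qed.

Lemma normc_mulmx_le m n p (S : 'M[C]_(m, n)) (T : 'M[C]_(n, p)) i j :
  normc ((S *m T) i j) <= \sum_k normc (S i k) * normc (T k j).
Proof.
rewrite mxE; apply: le_trans (normc_sum _) _.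
by apply: ler_sum => k _; rewrite ComplexField.Normc.normcM.
Qed.

(** A crude bound, needed before any element can be compared with the [sup]. *)
Lemma l2norm_mulmx_has_ubound n (V : set 'cV[C]_n) (T : 'M[C]_n) :
  has_ubound [set l2norm (T *m v) | v in V `&` [set v | l2norm v <= 1]].
Proof.
exists (\sum_i \sum_k normc (T i k)) => _ [v [_ /= v1] <-].
apply: le_trans (l2norm_le_sum _) _; apply: ler_sum => i _.
apply: le_trans (normc_mulmx_le _ _ _ _) _; apply: ler_sum => k _.
by rewrite ler_piMr ?normc_ge0 // (le_trans (normc_le_l2norm _ _)).
Qed.

Lemma l2norm_le_opnorm n (T : 'M[C]_n) (v : 'cV[C]_n) :
  l2norm v <= 1 -> l2norm (T *m v) <= opnorm T.
Proof.
by move=> v1; apply: (ub_le_sup (l2norm_mulmx_has_ubound _ _)); exists v.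
Qed.

Lemma l2norm0 n : l2norm (0 : 'cV[C]_n) = 0.
Proof.
rewrite /l2norm big1 ?sqrtr0 // => i _.
by rewrite mxE ComplexField.Normc.normc0 expr0n.
Qed.

Lemma opnorm_on_witness n (V : set 'cV[C]_n) (T : 'M[C]_n) (d : R) :
  d < opnorm_on V T -> V 0 ->
  exists v, [/\ V v, l2norm v <= 1 & d < l2norm (T *m v)].
Proof.
move=> /sup_gt ltd V0; case: ltd => [|_ [v [Vv v1] <-] ltd]; last by exists v.
by exists (l2norm (T *m 0)), 0 => //; split; rewrite //= l2norm0.
Qed.

Lemma normc_entry_le_opnorm n (T : 'M[C]_n) i j : normc (T i j) <= opnorm T.
Proof.
have norm1 : l2norm (delta_mx j 0 : 'cV[C]_n) <= 1.
  apply: le_trans (l2norm_le_sum _) _.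
  rewrite (bigD1 j) //= big1 => [|k neq_kj].
    by rewrite mxE !eqxx ComplexField.Normc.normc1 addr0.
  by rewrite mxE (negbTE neq_kj) ComplexField.Normc.normc0.
apply: le_trans (l2norm_le_opnorm T norm1).
by rewrite -colE; apply: le_trans (normc_le_l2norm _ i); rewrite mxE.
Qed.

(** Schur test: Jensen with weights [normc (T i j)] uses the row sums, and exchanging the two
    summations uses the column sums. *)
Lemma schur_test_contraction n (T : 'M[C]_n) :
  (forall i, \sum_j normc (T i j) <= 1) ->
  (forall j, \sum_i normc (T i j) <= 1) -> contraction T.
Proof.
move=> rowT colT; apply: ge_sup => [|_ [v [_ v1] <-]].
  by exists (l2norm (T *m 0)), 0 => //; split; rewrite //= l2norm0.
apply: le_trans v1; rewrite -ler_sqr ?nnegrE ?l2norm_ge0 // !sqr_l2norm.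
apply: (@le_trans _ _ (\sum_i \sum_j normc (T i j) * normc (v j 0) ^+ 2)).
  apply: ler_sum => i _.
  apply: le_trans (jensen_sqr _ _ (rowT i)) => [|j]; last exact: normc_ge0.
  rewrite ler_sqr ?nnegrE ?normc_ge0 ?normc_mulmx_le // sumr_ge0 // => j _.
  by rewrite mulr_ge0 ?normc_ge0.
rewrite exchange_big; apply: ler_sum => j _ /=.
by rewrite -mulr_suml ler_piMl ?sqr_ge0.
Qed.

Lemma Delta_growth n (T : 'M[C]_n) (a : C) (v : 'cV[C]_n) p :
  (T - a%:M) ^+ 2 *m v = 0 ->
  T ^+ p.+1 *m v = a ^+ p.+1 *: v + (p.+1%:R * a ^+ p) *: ((T - a%:M) *m v).
Proof.
move=> ker2; set w := (T - a%:M) *m v.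
have Tv : T *m v = a *: v + w by rewrite /w mulmxBl mul_scalar_mx addrC subrK.
have Tw : T *m w = a *: w.
  apply/eqP; rewrite -subr_eq0 -mul_scalar_mx -mulmxBl /w mulmxA.
  by rewrite mulmxE -expr2 ker2.
elim: p => [|p IH]; first by rewrite !expr1 expr0 mulr1 scale1r.
rewrite exprS -mulmxE -mulmxA IH mulmxDr -!scalemxAr Tv Tw scalerDr !scalerA.
rewrite -addrA -scalerDl; congr (_ *: _ + _ *: _); first by rewrite -exprSr.
by rewrite -mulrA -exprSr -[in RHS]natr1 mulrDl mul1r addrC.
Qed.

(** Take [v] in the unit ball with [w = (T - a) v] longer than [d]. In the growth formula the other
    two terms are at most [K] and 1 in each coordinate; summing over the [n] coordinates of [w]
    recovers [d]. *)
Lemma Delta_modulus_bound n (T : 'M[C]_n) (a : C) (K d : R) :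
  0 < d -> normc a <= 1 ->
  (forall p, (0 < p)%N -> opnorm (T ^+ p) <= K) ->
  d < opnorm_on (colker ((T - a%:M) ^+ 2)) (T - a%:M) ->
  forall p, p.+1%:R * normc a ^+ p <= n%:R * (K + 1) / d.
Proof.
move=> d0 a1 TK /opnorm_on_witness ltd p.
have [v [/= ker2 v1 dv]] := ltd (mulmx0 _ _).
have := Delta_growth p ker2; rewrite ler_pdivlMr //.
move: (_ *m v) dv => w dw growth.
have wi i : p.+1%:R * normc a ^+ p * normc (w i 0) <= K + 1.
  have -> : p.+1%:R * normc a ^+ p * normc (w i 0) =
      normc ((T ^+ p.+1 *m v) i 0 + - (a ^+ p.+1 * v i 0)).
    rewrite growth !mxE [a ^+ p.+1 * _ + _]addrC addrK.
    by rewrite !ComplexField.Normc.normcM normc_natr normcX.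
  apply: le_trans (le_normcD _ _) _; rewrite normcN lerD //.
    apply: le_trans (normc_le_l2norm _ _) _.
    by apply: le_trans (l2norm_le_opnorm _ v1) _; apply: TK.
  rewrite ComplexField.Normc.normcM normcX.
  rewrite mulr_ile1 ?exprn_ge0 ?normc_ge0 ?exprn_ile1 ?normc_ge0 //.
  exact: le_trans (normc_le_l2norm _ _) v1.
apply: (@le_trans _ _ (p.+1%:R * normc a ^+ p * \sum_i normc (w i 0))).
  rewrite ler_wpM2l ?mulr_ge0 ?exprn_ge0 ?normc_ge0 //.
  exact: le_trans (ltW dw) (l2norm_le_sum _).
rewrite mulr_sumr; apply: (@le_trans _ _ (\sum_(i < n) (K + 1))).
  exact: ler_sum.
by rewrite sumr_const card_ord mulr_natl.
Qed.

Lemma uniform_jordan_bound n (A : set 'M[C]_n) : uniform_jordan A ->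
  exists2 d : R, 0 < d & forall T a, A T -> Delta T a ->
    d < opnorm_on (colker ((T - a%:M) ^+ 2)) (T - a%:M).
Proof.
rewrite /uniform_jordan; set inf := ereal_inf _ => inf0.
have [d d0 dinf] : exists2 d : R, 0 < d & (d%:E < inf)%E.
  (* The infimum is [+oo] when every [Delta T] is empty; any positive [d] then serves. *)
  case: inf inf0 => [r|_|//]; last by exists 1; rewrite ?ltry.
  by rewrite lte_fin => r0; exists (r / 2); rewrite ?lte_fin; lra.
exists d => // T a AT aT; rewrite -lte_fin; apply: lt_le_trans dinf _.
apply: le_trans (ereal_inf_lbound _) (ereal_inf_lbound _).
  by exists T.
by exists a.
Qed.

End Norms.

(** * Changes of basis and diagonal rescaling *)

Section Rescaling.
Variable R : realType.
Local Notation C := R[i].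

Lemma normc_mulmx_bounded m n p q (P : 'M[C]_(m, n)) (Q : 'M[C]_(p, q))
    (K : R) :
  exists2 M : R, 0 <= M & forall T : 'M[C]_(n, p),
    (forall i j, normc (T i j) <= K) ->
    forall i j, normc ((P *m T *m Q) i j) <= M.
Proof.
pose rowP i := \sum_l normc (P i l); pose colQ j := \sum_k normc (Q k j).
have rowP0 k : 0 <= rowP k by rewrite sumr_ge0 // => l _; apply: normc_ge0.
have colQ0 k : 0 <= colQ k by rewrite sumr_ge0 // => l _; apply: normc_ge0.
have pos k l : 0 <= rowP k * `|K| * colQ l by rewrite !mulr_ge0.
(* The absolute value is there because [K] has no assumed sign; it keeps all terms nonnegative, so
   the full sum dominates each one. *)
exists (\sum_i \sum_j rowP i * `|K| * colQ j) => [|T TK i j].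
  by apply: sumr_ge0 => i _; apply: sumr_ge0.
apply: (@le_trans _ _ (rowP i * `|K| * colQ j)); last first.
  rewrite (bigD1 i) //= (bigD1 j) //= -addrA lerDl addr_ge0 ?sumr_ge0 // => k _.
  by rewrite sumr_ge0.
apply: le_trans (normc_mulmx_le _ _ _ _) _; rewrite mulr_sumr.
apply: ler_sum => k _; rewrite ler_wpM2r ?normc_ge0 //.
apply: le_trans (normc_mulmx_le _ _ _ _) _; rewrite mulr_suml.
apply: ler_sum => l _; rewrite ler_wpM2l ?normc_ge0 //.
exact: le_trans (TK _ _) (ler_norm _).
Qed.

Lemma expr_compress n (P Q T : 'M[C]_n) p :
  P *m Q = 1%:M -> Q *m P = 1%:M -> P *m T ^+ p *m Q = (P *m T *m Q) ^+ p.
Proof.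
move=> PQ QP; elim: p => [|p IH]; first by rewrite !expr0 mulmx1.
rewrite !exprSr -IH -!mulmxE !mulmxA.
by rewrite -(mulmxA (P *m T ^+ p) Q P) QP mulmx1.
Qed.

Definition scale_mx n (e : R) (B : 'M[C]_n) : 'M[C]_n :=
  \matrix_(i, j) ((e%:C%C) ^+ i * B i j * (e%:C%C)^-1 ^+ j).

Lemma scale_mxE n (e : R) (B : 'M[C]_n) :
  scale_mx e B = diag_mx (\row_i (e%:C%C) ^+ i) *m B *m
    diag_mx (\row_j (e%:C%C)^-1 ^+ j).
Proof. by apply/matrixP => i j; rewrite mul_mx_diag mul_diag_mx !mxE. Qed.

Lemma normc_scale_mx_diag n (e : R) (B : 'M[C]_n) i : 0 < e ->
  normc (scale_mx e B i i) = normc (B i i).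
Proof.
move=> e0; have e0C : e%:C%C != 0 :> C by rewrite (inj_eq (@complexI _)) gt_eqF.
by rewrite mxE mulrAC -exprMn divff // expr1n mul1r.
Qed.

(** Entry [(i, j)] is multiplied by [e ^ (i - j)]: above the diagonal it is zero anyway, and below
    it the exponent is at least 1. *)
Lemma normc_scale_mx_le n (e M : R) (B : 'M[C]_n) i j :
  0 < e <= 1 -> normc (B i j) <= M -> is_trig_mx B -> i != j ->
  normc (scale_mx e B i j) <= e * M.
Proof.
move=> /andP[e0 e1] BM /is_trig_mxP trigB neq_ij.
have M0 : 0 <= M := le_trans (normc_ge0 _) BM.
have [lt_ij|lt_ji|/val_inj eq_ij] := ltngtP i j.
- by rewrite mxE trigB // mulr0 mul0r ComplexField.Normc.normc0 mulr_ge0 // ltW.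
- rewrite mxE !ComplexField.Normc.normcM !normcX ComplexField.Normc.normcV.
  rewrite normc_real ?(ltW e0) // mulrAC exprVn -expfB //.
  rewrite ler_pM ?exprn_ge0 ?normc_ge0 ?(ltW e0) //.
  by rewrite -[leRHS]expr1 ler_wiXn2l ?subn_gt0 ?(ltW e0).
- by rewrite eq_ij eqxx in neq_ij.
Qed.

End Rescaling.

(** * Assembly of the similarity *)

Theorem theorem1p3 (R : realType) (n : nat) (A : set 'M[R[i]]_n) :
  (0 < n)%N ->
  commuting_family A ->
  uniformly_power_bounded A ->
  uniform_jordan A ->
  exists2 Y : 'M[R[i]]_n, Y \in unitmx &
    forall T, A T -> contraction (Y *m T *m invmx Y).
Proof.
move=> n0 Acomm [K K0 TK] /uniform_jordan_bound[d d0 dA].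
have [m [P [Q [PQ QP trigP]]]] := commuting_eigenblock_trig Acomm.
have emn : m = n by apply/eqP; rewrite eqn_leq (mulmx1_min PQ) (mulmx1_min QP).
subst m; have [M M0 PTQ] := normc_mulmx_bounded P Q K.
have entry T p i j : A T -> normc (((P *m T *m Q) ^+ p.+1) i j) <= M.
  move=> AT; rewrite -expr_compress //; apply: PTQ => k l.
  exact: le_trans (normc_entry_le_opnorm _ _ _) (TK _ AT _ _).
(* Powers of a diagonal entry are diagonal entries of powers, hence bounded. *)
have diag1 T i : A T -> normc ((P *m T *m Q) i i) <= 1.
  move=> AT; apply: (exp_bounded_le1 (M := M)); first exact: normc_ge0.
  move=> p; rewrite -normcX -(expr_trig_mx p.+1 (trigP _ AT).1).2; exact: entry.
have [c /andP[c0 c1] gap] := uniform_gap (n%:R * (K + 1) / d).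
have off T i j : A T -> i != j -> (P *m T *m Q) i j != 0 ->
    normc ((P *m T *m Q) i i) <= 1 - c.
  move=> AT neq_ij Bij; set a := (P *m T *m Q) i i.
  apply: gap; first by rewrite normc_ge0 diag1.
  apply: (Delta_modulus_bound d0 (diag1 _ _ AT) (TK _ AT)); apply: dA => //.
  (* If the two kernels agreed, this would transfer through [Q] to [P *m T *m Q] and force entry
     [(i, j)] to vanish. *)
  move=> kerT; move/eqP: (Bij); apply.
  apply: eigenblock_trig_semisimple (trigP _ AT) _ neq_ij => v.
  rewrite -((trigP _ AT).2 _ _ Bij) -/a.
  have -> : P *m T *m Q - a%:M = P *m (T - a%:M) *m Q.
    by rewrite mulmxBr mulmxBl mul_mx_scalar -scalemxAl PQ scalemx1.
  rewrite -expr_compress // -!mulmxA => /(congr1 (mulmx Q)).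
  rewrite mulmx0 mulmxA QP mul1mx => ker2.
  have : colker ((T - a%:M) ^+ 2) (Q *m v).
    by rewrite /colker /= expr2 -mulmxE -mulmxA.
  by rewrite -kerT /colker /= => ->; rewrite mulmx0.
(* Chosen so that [e * M <= c / n] and [e <= 1]; using [M + 1] avoids dividing by zero. *)
pose e : R := c / n%:R / (M + 1).
have M1 : 0 < M + 1 by rewrite ltr_wpDl.
have nR : 1 <= n%:R :> R by rewrite ler1n.
have n0R : 0 < n%:R :> R by rewrite ltr0n.
have e01 : 0 < e <= 1.
  apply/andP; split; first by rewrite /e !divr_gt0.
  rewrite /e !ler_pdivrMr // mul1r (le_trans c1) //.
  by rewrite mulr_ege1 // lerDr.
have eM : e * M <= c / n%:R.
  rewrite /e -mulrA ler_piMr //; first by rewrite divr_ge0 // ltW.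
  by rewrite mulrC ler_pdivrMr // mul1r lerDl ler01.
have e0C : e%:C%C != 0 :> R[i].
  by rewrite (inj_eq (@complexI _)) gt_eqF; case/andP: e01.
pose Dl : 'M[R[i]]_n := diag_mx (\row_i (e%:C%C) ^+ i).
pose Dr : 'M[R[i]]_n := diag_mx (\row_i (e%:C%C)^-1 ^+ i).
have DlDr : Dl *m Dr = 1%:M.
  rewrite mulmx_diag; apply/matrixP => i j; rewrite !mxE.
  by rewrite -exprMn divff // expr1n.
have YZ : (Dl *m P) *m (Q *m Dr) = 1%:M.
  by rewrite mulmxA -(mulmxA Dl) PQ mulmx1.
have [uY _] := mulmx1_unit YZ.
exists (Dl *m P) => // T AT.
have -> : invmx (Dl *m P) = Q *m Dr by rewrite -[RHS](mulKmx uY) YZ mulmx1.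
have -> : Dl *m P *m T *m (Q *m Dr) = scale_mx e (P *m T *m Q).
  by rewrite scale_mxE !mulmxA.
have small i j : i != j -> normc (scale_mx e (P *m T *m Q) i j) <= c / n%:R.
  move=> neq_ij; apply: le_trans eM.
  apply: normc_scale_mx_le => //; last exact: (trigP _ AT).1.
  by have := entry T 0%N i j AT; rewrite expr1.
have scale_diag i : normc (scale_mx e (P *m T *m Q) i i) =
    normc ((P *m T *m Q) i i).
  by apply: normc_scale_mx_diag; case/andP: e01.
have supp i j : normc (scale_mx e (P *m T *m Q) i j) != 0 ->
    (P *m T *m Q) i j != 0.
  apply: contra => /eqP B0.
  by rewrite mxE B0 mulr0 mul0r ComplexField.Normc.normc0.
apply: schur_test_contraction => k.
  apply: (sum_dominated_le1 (i := k) (c := c));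
    rewrite ?(ltW c0) ?scale_diag ?diag1 //.
    by move=> l neq_lk; apply: small; rewrite eq_sym.
  by move=> l neq_lk /supp; apply: off; rewrite // eq_sym.
apply: (sum_dominated_le1 (i := k) (c := c));
  rewrite ?(ltW c0) ?scale_diag ?diag1 //.
  by move=> l; apply: small.
(* In a column, [off] bounds the diagonal entry of row [l], which equals that of [k] because a
   nonzero entry links them. *)
move=> l neq_lk /supp Blk; rewrite -((trigP _ AT).2 _ _ Blk).
exact: off Blk.
Qed.
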